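(* Let $G$ be a connected graph of order $n$, minimum degree $\delta \geq 3$ and girth at least $6$. Then \[ \operatorname{avec}(G) \leq \frac{9}{2} \Big\lceil \frac{n}{\delta^*} \Big\rceil + 8, \] where $\delta^* = 2\delta^2-2\delta+2$.
   Context: All graphs are finite and simple. For a connected graph $G$, the eccentricity $e_G(v)$ of a vertex $v$ is $\max_{w\in V(G)} d_G(v,w)$, where $d_G$ is the usual shortest-path distance. The average eccentricity of $G$ is $\operatorname{avec}(G)=\frac{1}{n}\sum_{v\in V(G)} e_G(v)$, where $n=|V(G)|$. The girth of $G$ is the length of a shortest cycle in $G$ (infinite if $G$ is acyclic). *)

(* Defs.v *)
From mathcomp Require Import all_boot all_order all_algebra.

Set Implicit Arguments.
Unset Strict Implicit.
Unset Printing Implicit Defensive.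

Import Order.TTheory GRing.Theory Num.Theory.

(* A finite simple graph is an adjacency relation [e : rel T]
   on a finType [T]; [simple_graph] is the condition that it is loopless and
   undirected. *)

Section Graph.
Variables (T : finType) (e : rel T).

Definition simple_graph : Prop := symmetric e /\ irreflexive e.

Definition connected_graph : Prop :=
  0 < #|T| /\ forall x y : T, connect e x y.

Definition degree (v : T) : nat := #|[set w | e v w]|.

(* The default value #|T| exceeds every degree of a simple graph, so it is
   attained only when T is empty. *)
Definition min_degree : nat := \big[minn/#|T|]_(v : T) degree v.

Definition has_path_of_length (x y : T) (k : nat) : bool :=
  [exists p : k.-tuple T, [&& path e x p, uniq (x :: p) & last x p == y]].

(* A path has at most #|T| - 1 edges, so the default value #|T| is attained
   only when there is no path from x to y. *)
Definition dist (x y : T) : nat :=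
  \big[minn/#|T|]_(k < #|T| | has_path_of_length x y k) k.

Definition ecc (v : T) : nat := \max_(w : T) dist v w.

Definition avec : rat := ((\sum_(v : T) ecc v)%N%:R / #|T|%:R)%R.

(* The bound 2 < k is needed because, e being symmetric, an edge traversed
   back and forth satisfies [ucycleb]. *)
Definition has_cycle_of_length (k : nat) : bool :=
  (2 < k) && [exists c : k.-tuple T, ucycleb e c].

(* [None] stands for infinite girth. *)
Definition girth : option nat :=
  ohead [seq k <- iota 0 #|T|.+1 | has_cycle_of_length k].

Definition girth_at_least (g : nat) : bool :=
  if girth is Some m then g <= m else true.

End Graph.

Definition delta_star (d : nat) : rat :=
  (2 * d%:R ^+ 2 - 2 * d%:R + 2)%R.

(* Main.v *)
(* In a graph of girth at least 6 the vertices within distance 2 of an edge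
   number at least delta* = 2 delta + 2 (delta - 1)^2. Greedily choose edges
   whose balls of radius 2 are disjoint, each new edge at distance exactly 5
   from an earlier one; this gives a tree on the set M of chosen edges, and at
   the end every vertex is within distance 5 of M. A tree step costs at most
   1 + 5 in the graph, so ecc v <= 6 E(phi v) + 11, where phi v is the chosen
   edge whose ball contains v (or else one within distance 5 of v) and E is the
   eccentricity in the tree. Along a diametral path f_0, ..., f_d of the tree
   E(f_i) = max(i, d - i), and each f_i receives at least delta* vertices, so
   sum_v E(phi v) <= n d - delta* floor(d^2 / 4). With K = ceil (n / delta* ),
   from d + 1 <= K and n <= K delta* the mean of E(phi v) is at most
   3 K / 4 - 1 / 2, and 6 (3 K / 4 - 1 / 2) + 11 = 9 K / 2 + 8. *)
Require Import Defs.
From mathcomp Require Import all_boot all_order all_algebra.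
From mathcomp Require Import zify ring lra.

Set Implicit Arguments.
Unset Strict Implicit.
Unset Printing Implicit Defensive.

Import Order.TTheory GRing.Theory Num.Theory.

(** * Minima, disjoint families and a quadratic sum over the naturals *)

Section BigNat.

Lemma bigminn_leq (I : eqType) (r : seq I) (P : pred I) (F : I -> nat) x0 i :
  i \in r -> P i -> \big[minn/x0]_(j <- r | P j) F j <= F i.
Proof.
elim: r => // a r IHr; rewrite inE big_cons => /predU1P[<- ->|ir Pi].
  exact: geq_minl.
have := IHr ir Pi; case: ifP => // _ le; exact: leq_trans (geq_minr _ _) le.
Qed.

Lemma sum_card_disjoint (I T : finType) (S : {set I}) (F : I -> {set T})
    (B : {set T}) :
    (forall i, i \in S -> F i \subset B) ->
    (forall i j x, i \in S -> j \in S -> x \in F i -> x \in F j -> i = j) ->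
  \sum_(i in S) #|F i| <= #|B|.
Proof.
move=> subB disjF.
have -> : \sum_(i in S) #|F i| = \sum_(x in B) \sum_(i in S | x \in F i) 1.
  rewrite (exchange_big_dep (mem S)) /=; last by move=> x i _ /andP[].
  apply: eq_bigr => i iS; rewrite -sum1_card; apply: eq_bigl => x.
  by rewrite iS; case: (boolP (x \in F i)) => [/(subsetP (subB i iS))->|];
    rewrite ?andbF.
rewrite -sum1_card; apply: leq_sum => x _; rewrite sum1_card.
apply/card_le1_eqP => i j; rewrite !unfold_in => /andP[iS xi] /andP[jS xj].
exact: (disjF _ _ x).
Qed.

(** The sum is floor(d^2 / 4), the 1 being lost for odd d. From d to d + 2, the two end terms vanish
    and each of the d + 1 inner terms exceeds an old one by 1, which matches (d + 2)^2 = d^2 + 4 (d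
    + 1). *)
Lemma sqr_leq_sum_minn d : d ^ 2 <= 4 * (\sum_(i < d.+1) minn i (d - i)) + 1.
Proof.
have [k] := ubnP d; elim: k d => // k IHk [|[|d]] dk //; first exact: leq_addl.
rewrite big_ord_recl big_ord_recr /= min0n subnn minn0 addn0 add0n.
rewrite (eq_bigr (fun i : 'I_d.+1 => 1 + minn i (d - i))); last first.
  by move=> i _; rewrite /bump /=; have := ltn_ord i; lia.
rewrite big_split /= sum_nat_const card_ord.
have := IHk d (ltnW dk); rewrite -!mulnn; set s := \sum_(i < _) _.
move: s => s; nia.
Qed.

End BigNat.

(** * Tree metrics *)

Section TreeMetric.
Variable I : finType.
Implicit Types (M : {set I}) (D : I -> I -> nat).

(* Among integer-valued geodesic metrics those of trees are characterised by the
   four-point condition. Positivity of [D x y] for distinct x, y is not asked. *)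
Record tree_metric M D : Prop := TreeMetric {
  tree_refl : forall x, D x x = 0;
  tree_sym : forall x y, D x y = D y x;
  tree_four_point : forall x y z w,
    x \in M -> y \in M -> z \in M -> w \in M ->
    D x y + D z w <= maxn (D x z + D y w) (D x w + D y z);
  tree_geodesic : forall x y i, x \in M -> y \in M -> i <= D x y ->
    exists2 z, z \in M & D x z = i /\ D z y = D x y - i }.

Lemma tree_metric1 x : tree_metric [set x] (fun _ _ => 0).
Proof.
split=> // y z i _ _; rewrite leqn0 => /eqP->.
by exists x; rewrite ?set11.
Qed.

Definition add_leaf (g f : I) D x y :=
  if x == g then if y == g then 0 else (D f y).+1
  else if y == g then (D f x).+1 else D x y.

(** Replacing [g] by its parent [f] lowers each pair sum of the four-point condition by the number
    of occurrences of [g], unless a pair consists of two copies of [g]; then the other two sums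
    coincide. A geodesic at [g] extends one at [f]. *)
Lemma tree_metric_add_leaf M D g f :
    tree_metric M D -> f \in M -> g \notin M ->
  tree_metric (g |: M) (add_leaf g f D).
Proof.
case=> D0 Dsym D4 Dgeo fM gM.
have memM x : x \in M -> (x == g) = false.
  by move=> xM; apply: contraNF gM => /eqP<-.
split.
- by move=> x; rewrite /add_leaf; case: eqVneq.
- by move=> x y; rewrite /add_leaf (Dsym x y); do 2 case: (_ == g).
- move=> x y z w; rewrite !inE /add_leaf.
  have parent u : (u == g) || (u \in M) -> (if u == g then f else u) \in M.
    by case: ifP.
  move=> /parent xM /parent yM /parent zM /parent wM.
  have := D4 _ _ _ _ xM yM zM wM; clear -D0 Dsym.
  case: (x == g); case: (y == g); case: (z == g); case: (w == g);
    rewrite ?D0 ?(Dsym x f) ?(Dsym y f) ?(Dsym z f);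
    rewrite ?(Dsym w f); lia.
- move=> x y i; rewrite !inE /add_leaf.
  case: (eqVneq x g) => [-> _|xg xM]; case: (eqVneq y g) => [-> _|yg yM] //=.
  + by move=> ile; exists g; rewrite ?inE eqxx; lia.
  + case: i => [_|i lei]; first by exists g; rewrite ?inE eqxx.
    have [z zM [zi zy]] := Dgeo f y i fM yM lei.
    by exists z; rewrite ?inE ?zM ?orbT // memM // zi zy.
  + case: (leqP i (D f x)) => [lei|lti lei]; last first.
      by exists g; rewrite ?inE eqxx //; lia.
    have [z zM [zi zy]] := Dgeo x f i xM fM ltac:(by rewrite Dsym).
    exists z; rewrite ?inE ?zM ?orbT // memM // zi Dsym zy Dsym; lia.
  + move=> lei; have [z zM zP] := Dgeo x y i xM yM lei.
    by exists z; rewrite ?inE ?zM ?orbT // memM.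
Qed.

Definition tree_ecc M D x := \max_(y in M) D x y.

Lemma leq_tree_ecc M D x y : y \in M -> D x y <= tree_ecc M D x.
Proof. by move=> yM; apply: leq_bigmax_cond. Qed.

(* On a longest path v_0, ..., v_d the vertex v_i has eccentricity at most
   max(i, d - i) by the four-point condition; distinct v_i are told apart by
   their distance to v_0. *)
Lemma tree_ecc_diameter M D : M != set0 -> tree_metric M D ->
  exists d, [/\ forall x, x \in M -> tree_ecc M D x <= d, d < #|M|
    & \sum_(i < d.+1) minn i (d - i) <= \sum_(x in M) (d - tree_ecc M D x)].
Proof.
case/set0Pn=> x0 x0M [D0 Dsym D4 Dgeo].
have [a aM amax] : exists2 a, a \in M &
    forall x, x \in M -> tree_ecc M D x <= tree_ecc M D a.
  by case: (arg_maxnP (tree_ecc M D) x0M) => a; exists a.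
have [b bM dE] : exists2 b, b \in M & tree_ecc M D a = D a b.
  have M0 : 0 < #|M| by apply/card_gt0P; exists x0.
  by have [b] := eq_bigmax_cond (D a) M0; exists b.
rewrite dE in amax; set d := D a b in amax *.
have Dd x y : x \in M -> y \in M -> D x y <= d.
  by move=> xM yM; apply: leq_trans (amax x xM); apply: leq_tree_ecc.
have fiber (i : 'I_d.+1) : exists2 v, v \in M & D a v = i /\ D v b = d - i.
  by apply: Dgeo => //; rewrite -ltnS.
have part (F : I -> nat) : \sum_(x in M) F x =
    \sum_(i < d.+1) \sum_(x in M | inord (D a x) == i) F x.
  exact: partition_big.
exists d; split=> //.
  rewrite -[d.+1]card_ord -!sum1_card part; apply: leq_sum => i _.
  have [v vM [vi _]] := fiber i.
  by rewrite (bigD1 v) //= vM vi inord_val eqxx.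
rewrite part; apply: leq_sum => i _; have [v vM [vi vb]] := fiber i.
rewrite (bigD1 v) /=; last by rewrite vM vi inord_val eqxx.
apply: leq_trans (leq_addr _ _).
suff : tree_ecc M D v <= maxn i (d - i) by have := ltn_ord i; lia.
apply/bigmax_leqP => y yM.
(* This reads D v y + d <= max(i + D y b, (d - i) + D a y), where D y b and D a y are at most d. *)
have := D4 v y a b vM yM aM bM; rewrite -/d (Dsym v a) (Dsym y a) vi vb.
have := Dd a y aM yM; have := Dd y b yM bM; lia.
Qed.

End TreeMetric.

(** * Balls around edges in graphs of girth at least six *)

Section Within.
Variables (T : finType) (e : rel T).

(** Walks replace the simple paths of [dist], so that they can be concatenated without any check of
    uniqueness; [dist_within] returns to [dist]. *)
Fixpoint within k x y :=
  (x == y) || if k is k'.+1 then [exists z, e x z && within k' z y] else false.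

Lemma withinP k x y :
  reflect (exists p, [/\ path e x p, last x p = y & size p <= k])
          (within k x y).
Proof.
elim: k x => [|k IHk] x /=.
  rewrite orbF; apply: (iffP eqP) => [->|[[|z p] [] //]].
  by exists [::].
apply: (iffP orP) => [[/eqP->|/existsP[z /andP[xz /IHk[p [pp lp sp]]]]]|].
- by exists [::].
- by exists (z :: p); rewrite /= xz.
case=> -[|z p] [/= ]; first by move=> _ ->; left.
case/andP=> xz pp lp sp; right; apply/existsP; exists z; rewrite xz.
by apply/IHk; exists p.
Qed.

Lemma within_refl k x : within k x x.
Proof. by apply/withinP; exists [::]. Qed.

Lemma within_edge x y : e x y -> within 1 x y.
Proof. by move=> xy; apply/withinP; exists [:: y]; rewrite /= xy. Qed.

Lemma within_leq k l x y : k <= l -> within k x y -> within l x y.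
Proof.
move=> kl /withinP[p [pp lp sp]]; apply/withinP; exists p.
by rewrite (leq_trans sp kl).
Qed.

Lemma within_trans k l x y z :
  within k x y -> within l y z -> within (k + l) x z.
Proof.
move=> /withinP[p [pp lp sp]] /withinP[q [pq lq sq]].
apply/withinP; exists (p ++ q).
by rewrite cat_path last_cat size_cat lp pp pq lq leq_add.
Qed.

Lemma within_sym k x y : symmetric e -> within k x y -> within k y x.
Proof.
move=> e_sym /withinP[p [pp lp sp]]; apply/withinP.
exists (rev (belast x p)); split.
- by rewrite -lp rev_path; rewrite (eq_path (e' := e)) // => u v; rewrite e_sym.
- by case: p {pp sp} lp => //= z p _; rewrite rev_cons last_rcons.
- by rewrite size_rev size_belast.
Qed.

Lemma dist_within k x y : within k x y -> dist e x y <= k.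
Proof.
case/withinP=> p [pp <- sp].
(* A simple path has fewer than [#|T|] edges, so its length lies in the index range of the minimum
   defining [dist]. *)
case/shortenP: pp => q qq uq sub.
have qp : size q <= size p by case/andP: (uq) => _ /uniq_leq_size; apply.
have qT : size q < #|T|.
  by rewrite -[(size q).+1]/(size (x :: q)) -(card_uniqP uq) max_card.
apply: leq_trans (leq_trans qp sp); rewrite /dist.
apply: (@bigminn_leq _ _ _ _ _ (Ordinal qT)); first by rewrite mem_index_enum.
by apply/existsP; exists (in_tuple q); apply/and3P.
Qed.

End Within.

Arguments within : simpl never.

Section GirthSix.
Variables (T : finType) (e : rel T).
Hypotheses (e_irr : irreflexive e) (e_girth : girth_at_least e 6).

(** The list of cycle lengths is increasing, so its head, the girth, is at most the length of any
    cycle. *)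
Lemma no_short_cycle (c : seq T) :
  2 < size c < 6 -> cycle e c -> uniq c -> False.
Proof.
case/andP=> c3 c6 ec uc.
have cyc : has_cycle_of_length e (size c).
  by rewrite /has_cycle_of_length c3; apply/existsP; exists (in_tuple c);
    rewrite /ucycleb ec.
have : size c \in [seq k <- iota 0 #|T|.+1 | has_cycle_of_length e k].
  rewrite mem_filter cyc mem_iota add0n ltnS -(card_uniqP uc).
  exact: max_card.
have : sorted ltn [seq k <- iota 0 #|T|.+1 | has_cycle_of_length e k].
  by apply: sorted_filter (iota_ltn_sorted _ _); apply: ltn_trans.
move: e_girth; rewrite /girth_at_least /girth.
case: [seq k <- _ | _] => //= m s m6.
rewrite (path_sortedE ltn_trans) inE => /andP[/allP sm _].
by case/predU1P=> [|/sm]; lia.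
Qed.

Lemma edge_neq x y : e x y -> x != y.
Proof. by apply: contraTneq => ->; rewrite e_irr. Qed.

Lemma no_triangle a b c : e a b -> e b c -> e c a -> False.
Proof.
move=> ab bc ca; apply: (@no_short_cycle [:: a; b; c]) => //=.
  by rewrite ab bc ca.
by rewrite !inE negb_or (edge_neq ab) (edge_neq bc) eq_sym (edge_neq ca).
Qed.

Lemma no_quadrangle a b c d :
  e a b -> e b c -> e c d -> e d a -> a != c -> b != d -> False.
Proof.
move=> ab bc cd da ac bd; apply: (@no_short_cycle [:: a; b; c; d]) => //=.
  by rewrite ab bc cd da.
by rewrite !inE !negb_or ac bd (edge_neq ab) (edge_neq bc) (edge_neq cd) eq_sym
  (edge_neq da).
Qed.

Lemma no_pentagon a b c d f :
  e a b -> e b c -> e c d -> e d f -> e f a -> False.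
Proof.
move=> ab bc cd df fa.
(* Non-adjacent vertices of the pentagon are joined by three of its edges, which would form a
   triangle if the two vertices were equal. *)
have neq x y z t : e x y -> e y z -> e z t -> x != t.
  by move=> xy yz zt; apply/eqP=> xt; apply: (no_triangle xy yz);
    rewrite xt.
apply: (@no_short_cycle [:: a; b; c; d; f]) => //=.
  by rewrite ab bc cd df fa.
have ac : a != c by rewrite eq_sym (neq c d f a).
have ad : a != d by rewrite (neq a b c d).
have bd : b != d by rewrite eq_sym (neq d f a b).
have bf : b != f by rewrite (neq b c d f).
have cf : c != f by rewrite eq_sym (neq f a b c).
by rewrite !inE !negb_or ac ad bd bf cf (edge_neq ab) (edge_neq bc) (edge_neq cd)
  (edge_neq df) eq_sym (edge_neq fa).
Qed.

End GirthSix.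

Section EdgeBall.
Variables (T : finType) (e : rel T) (delta : nat).
Hypotheses (e_sym : symmetric e) (e_irr : irreflexive e).
Hypothesis e_girth : girth_at_least e 6.
Hypothesis degree_ge : forall v, delta <= degree e v.

Definition nbhd v := [set w | e v w].

Definition second_nbhd u v := \bigcup_(w in nbhd u :\ v) (nbhd w :\ u).

Definition edge_ball (p : T * T) :=
  [set w | within e 2 p.1 w || within e 2 p.2 w].

Lemma second_nbhdP u v x :
  reflect (exists w, [/\ e u w, w != v, e w x & x != u])
          (x \in second_nbhd u v).
Proof.
apply: (iffP bigcupP) => [[w]|[w [uw wv wx xu]]]; last exists w;
  rewrite !inE ?uw ?wv ?wx ?xu //.
by move=> /andP[wv uw] /andP[xu wx]; exists w.
Qed.

Lemma card_nbhdD1 u v : delta.-1 <= #|nbhd u :\ v|.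
Proof.
have := degree_ge u; rewrite /degree -/(nbhd u) (cardsD1 v).
by case: (_ \in _); lia.
Qed.

(** The sets [nbhd w :\ u] are disjoint for distinct neighbours w of u: a common vertex would close
    a 4-cycle through u. *)
Lemma card_second_nbhd u v : delta.-1 ^ 2 <= #|second_nbhd u v|.
Proof.
apply: leq_trans (@sum_card_disjoint _ _ (nbhd u :\ v)
  (fun w => nbhd w :\ u) _ _ _).
- rewrite -mulnn; apply: (@leq_trans (\sum_(w in nbhd u :\ v) delta.-1)).
    by rewrite sum_nat_const leq_mul2r card_nbhdD1 orbT.
  by apply: leq_sum => w _; apply: card_nbhdD1.
- by move=> w wu; apply: bigcup_sup wu.
- move=> w w' x; rewrite !inE => /andP[_ uw] /andP[_ uw'].
  move=> /andP[xu wx] /andP[_ w'x].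
  case: (eqVneq w w') => // ww'.
  case: (@no_quadrangle _ e e_irr e_girth u w x w') => //; last by rewrite eq_sym.
    by rewrite e_sym.
  by rewrite e_sym.
Qed.

(** The first and second neighbourhoods of both ends are four disjoint subsets of the ball, since a
    common vertex would close a cycle of length 3, 4 or 5. The ends are counted too, each as a
    neighbour of the other. *)
Lemma card_edge_ball u v : e u v ->
  2 * delta + 2 * delta.-1 ^ 2 <= #|edge_ball (u, v)|.
Proof.
move=> uv; have vu : e v u by rewrite e_sym.
have disjNN : [disjoint nbhd u & nbhd v].
  apply/pred0P => x /=; rewrite !inE; apply/negP => /andP[ux vx].
  by apply: (no_triangle e_irr e_girth uv vx); rewrite e_sym.
have disjN a b : [disjoint nbhd a & second_nbhd a b].
  apply/pred0P => x /=; rewrite !inE; apply/negP.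
  move=> /andP[ax /second_nbhdP[w [aw _ wx _]]].
  by apply: (no_triangle e_irr e_girth aw wx); rewrite e_sym.
have disjNS a b : e a b -> [disjoint nbhd a & second_nbhd b a].
  move=> ab; apply/pred0P => x /=; rewrite !inE; apply/negP.
  move=> /andP[ax /second_nbhdP[w [bw wa wx xb]]].
  apply: (no_quadrangle e_irr e_girth ab bw wx); rewrite 1?e_sym // eq_sym //.
have disjSS : [disjoint second_nbhd u v & second_nbhd v u].
  apply/pred0P => x /=; apply/negP.
  move=> /andP[/second_nbhdP[w [uw _ wx _]] /second_nbhdP[w' [vw' _ w'x _]]].
  rewrite e_sym in wx.
  by apply: (no_pentagon e_irr e_girth uv vw' w'x wx); rewrite e_sym.
have sub a b x : (x \in nbhd a) || (x \in second_nbhd a b) -> within e 2 a x.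
  case/orP=> [|/second_nbhdP[w [aw _ wx _]]].
    by rewrite inE => /within_edge; apply: within_leq.
  exact: within_trans (within_edge aw) (within_edge wx).
have cU (A B : {set T}) : [disjoint A & B] -> #|A :|: B| = #|A| + #|B|.
  by move=> dAB; apply/eqP; rewrite (leq_card_setU A B).2.
have -> : 2 * delta + 2 * delta.-1 ^ 2 =
  (delta + delta.-1 ^ 2) + (delta + delta.-1 ^ 2) by lia.
apply: (@leq_trans #|(nbhd u :|: second_nbhd u v) :|:
                     (nbhd v :|: second_nbhd v u)|).
  rewrite cU; last first.
    rewrite -setI_eq0 !setIUl !setIUr !setU_eq0 !setI_eq0 disjNN disjSS disjNS //.
    by rewrite disjoint_sym disjNS.
  rewrite !cU //.
  by rewrite !leq_add ?degree_ge ?card_second_nbhd.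
apply/subset_leq_card/subsetP => x; rewrite !in_setU => xuv.
by rewrite in_set /=; case/orP: xuv => /sub ->; rewrite ?orbT.
Qed.

End EdgeBall.

(** * Packing disjoint balls along a tree *)

Section Packing.
Variables (T : finType) (e : rel T).
Hypotheses (e_sym : symmetric e) (e_conn : forall x y, connect e x y).

Implicit Types (M : {set T * T}) (f g : T * T) (a x y : T).

(* [M] is a set of oriented edges; the contact graph of the greedy
   construction is a tree on [M], of which [D] is the distance. *)
Record packing M D : Prop := Packing {
  packing_edge : forall f, f \in M -> e f.1 f.2;
  packing_disjoint : forall f g x, f \in M -> g \in M ->
    x \in edge_ball e f -> x \in edge_ball e g -> f = g;
  packing_tree : tree_metric M D;
  packing_dist : forall f g x y, f \in M -> g \in M ->
    x \in [:: f.1; f.2] -> y \in [:: g.1; g.2] ->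
    within e (6 * D f g).+1 x y }.

Definition near (M : {set T * T}) k x :=
  [exists f in M, within e k f.1 x || within e k f.2 x].

Lemma nearP M k x :
  reflect (exists f a, [/\ f \in M, a \in [:: f.1; f.2] & within e k a x])
          (near M k x).
Proof.
apply: (iffP exists_inP) => [[f fM /orP[fx|fx]]|[f [a [fM]]]].
- by exists f, f.1; rewrite !inE eqxx.
- by exists f, f.2; rewrite !inE eqxx orbT.
by rewrite !inE => /orP[] /eqP-> fx; exists f; rewrite ?fx ?orbT.
Qed.

Lemma near_trans M k l x y : near M k x -> within e l x y -> near M (k + l) y.
Proof.
move=> /nearP[f [a [fM af ax]]] xy; apply/nearP; exists f, a; split=> //.
exact: within_trans xy.
Qed.

Lemma edge_ballP f x :
  reflect (exists2 a, a \in [:: f.1; f.2] & within e 2 a x)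
          (x \in edge_ball e f).
Proof.
rewrite inE; apply: (iffP orP) => [[fx|fx]|[a]].
- by exists f.1; rewrite ?inE ?eqxx.
- by exists f.2; rewrite ?inE ?eqxx ?orbT.
by rewrite !inE => /orP[] /eqP->; [left|right].
Qed.

Lemma packing1 u v : e u v -> packing [set (u, v)] (fun _ _ => 0).
Proof.
move=> uv; split.
- by move=> f /set1P->.
- by move=> f g x /set1P-> /set1P->.
- exact: tree_metric1.
move=> f g x y /set1P-> /set1P->; rewrite muln0 !inE /=.
have [uv1 vu1] : within e 1 u v /\ within e 1 v u.
  by split; apply: within_edge; rewrite // e_sym.
by do 2 (case/orP=> /eqP->); rewrite ?within_refl.
Qed.

Lemma crossing_edge (A : pred T) x y : A x -> ~~ A y ->
  exists z t, [/\ e z t, A z & ~~ A t].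
Proof.
case/connectP: (e_conn x y) => p pp ->; elim: p x pp => /= [x _ ->//|z p IHp x].
move=> /andP[xz zp] Ax; have [Az|nAz _] := boolP (A z); first exact: IHp.
by exists x, z.
Qed.

(** Some edge yz leaves the set of vertices within 5 of M. Both its ends are farther than 4 from M,
    so its ball of radius 2 misses the earlier balls, while y is within 5 of some f in M, which
    becomes the parent of yz. *)
Lemma packing_extend M D w : packing M D -> M != set0 -> ~~ near M 5 w ->
  exists M' D', packing M' D' /\ #|M| < #|M'|.
Proof.
case=> M_edge M_disj M_tree M_dist /set0Pn[f0 f0M] farw.
have near_f0 : near M 5 f0.1.
  by apply/nearP; exists f0, f0.1; rewrite within_refl !inE eqxx.
have [y [z [yz near_y far_z]]] := crossing_edge near_f0 farw.
have far4 x : x \in [:: y; z] -> ~~ near M 4 x.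
  rewrite !inE => /orP[]/eqP->; apply: contra far_z => near4.
    exact: near_trans near4 (within_edge yz).
  by have := near_trans near4 (within_refl e 1 z).
have [f [a [fM af ay]]] := nearP _ _ _ near_y.
have gM : (y, z) \notin M.
  apply: contra far_z => gM; apply/nearP; exists (y, z), z.
  by rewrite within_refl !inE eqxx orbT.
have M_tree' := tree_metric_add_leaf M_tree fM gM.
exists ((y, z) |: M), (add_leaf (y, z) f D); split; last first.
  by rewrite cardsU1 gM.
have disj g x : g \in M -> x \in edge_ball e (y, z) -> x \in edge_ball e g ->
    False.
  move=> hM /edge_ballP[b bg bx] /edge_ballP[c ch cx].
  apply/negP: (far4 b bg); rewrite negbK; apply/nearP; exists g, c; split=> //.
  exact: (within_trans cx (within_sym e_sym bx)).
(* At most 1 from b to y, 5 from y to f, and 6 D f g + 1 from f to c make 6 (D f g + 1) + 1. *)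
have dist_new g b c : g \in M -> b \in [:: y; z] -> c \in [:: g.1; g.2] ->
    within e (6 * (D f g).+1).+1 b c.
  move=> hM bg ch.
  have by1 : within e 1 b y.
    move: bg; rewrite !inE => /orP[]/eqP->; rewrite ?within_refl //.
    by apply: within_edge; rewrite e_sym.
  apply: within_leq (within_trans (within_trans by1 (within_sym e_sym ay))
    (M_dist _ _ _ _ fM hM af ch)).
  by rewrite mulnS addnS.
have [D0 Dsym _ _] := M_tree.
split=> //.
- by move=> g /setU1P[->|/M_edge].
- move=> g h x /setU1P[->|gM1] /setU1P[->|hM] // xg xh.
  + by case: (disj h x).
  + by case: (disj g x).
  + exact: (M_disj g h x).
- have memM g : g \in M -> (g == (y, z)) = false.
    by move=> hM; apply: contraNF gM => /eqP<-.
  move=> g h b c /setU1P[->|gM1] /setU1P[->|hM] bg ch; rewrite /add_leaf.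
  + rewrite eqxx muln0; move: bg ch; rewrite !inE /=.
    have zy : e z y by rewrite e_sym.
    by do 2 (case/orP=> /eqP->); rewrite ?within_refl ?within_edge.
  + by rewrite eqxx memM //; apply: dist_new.
  + by rewrite eqxx memM //; apply: within_sym => //; apply: dist_new.
  + by rewrite !memM //; apply: M_dist.
Qed.

(** Greedy extension stops because M grows inside the finite set of vertex pairs. *)
Lemma packing_covering M D : packing M D -> M != set0 ->
  exists M' D', [/\ packing M' D', M' != set0 & forall w, near M' 5 w].
Proof.
have [k] := ubnP (#|{: T * T}| - #|M|); elim: k M D => // k IHk M D Mk packM M0.
case: (boolP [forall w, near M 5 w]) => [/forallP cover|].
  by exists M, D.
case/forallPn=> w /(packing_extend packM M0)[M' [D' [packM' MM']]].
apply: IHk packM' _; last by rewrite -card_gt0; lia.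
have M'max : #|M'| <= #|{: T * T}| by apply: max_card.
move: Mk MM' M'max; move: #|M| #|M'| #|{: T * T}| => m m' n; lia.
Qed.

End Packing.

(** * Summing eccentricities over a covering packing *)

Section EccentricitySum.
Variables (T : finType) (e : rel T) (delta : nat).
Hypotheses (e_sym : symmetric e) (e_irr : irreflexive e).
Hypotheses (e_conn : forall x y, connect e x y) (e_girth : girth_at_least e 6).
Hypotheses (T_gt0 : 0 < #|T|) (delta_gt0 : 0 < delta).
Hypothesis degree_ge : forall v, delta <= degree e v.

Let c := 2 * delta + 2 * delta.-1 ^ 2.

(** Here d is the tree diameter, s the sum of min(i, d - i) along a diametral path, and E the sum
    over all vertices of the tree eccentricity of their assigned edge. *)
Lemma sum_ecc_bound : exists d s E,
  [/\ d.+1 * c <= #|T|, \sum_v ecc e v <= 6 * E + 11 * #|T|,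
      E + c * s <= #|T| * d & d ^ 2 <= 4 * s + 1].
Proof.
have [M [D [packM M0 cover]]] : exists M D,
    [/\ packing e M D, M != set0 & forall w, near e M 5 w].
  have [v _] : exists v : T, v \in T by apply/card_gt0P.
  have /card_gt0P[u] : 0 < degree e v by apply: leq_trans (degree_ge v).
  rewrite inE => vu; apply: (packing_covering e_sym e_conn (packing1 e_sym vu)).
  by apply/set0Pn; exists (v, u); rewrite set11.
have [M_edge M_disj M_tree M_dist] := packM.
have [d [E_le_d dM sumM]] := tree_ecc_diameter M0 M_tree.
have ball_ge f : f \in M -> c <= #|edge_ball e f|.
  case: f => u v fM.
  have uv : e u v by apply: M_edge fM.
  exact (card_edge_ball e_sym e_irr e_girth degree_ge uv).
have [phi phiP] : exists phi : T -> T * T, forall w,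
    [/\ phi w \in M, exists2 a, a \in [:: (phi w).1; (phi w).2] & within e 5 a w
      & forall f, f \in M -> w \in edge_ball e f -> phi w = f].
  suff phi_ex : forall w, exists f, [/\ f \in M,
      exists2 a, a \in [:: f.1; f.2] & within e 5 a w
    & forall g, g \in M -> w \in edge_ball e g -> f = g].
    exact: (fin_all_exists phi_ex).
  move=> w.
  have [/exists_inP[f fM wf]|] := boolP [exists f in M, w \in edge_ball e f].
    exists f; split=> // [|g gM wg]; last exact: M_disj wf wg.
    by have [a af aw] := edge_ballP _ _ _ wf; exists a => //; apply: within_leq aw.
  move/exists_inPn => far; have [f [a [fM af aw]]] := nearP _ _ _ _ (cover w).
  exists f; split=> // [|g gM wg]; first by exists a.
  by have := far g gM; rewrite wg.
pose ecM := tree_ecc M D.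
exists d, (\sum_(i < d.+1) minn i (d - i)), (\sum_w ecM (phi w)); split.
- rewrite -cardsT; apply: leq_trans (@sum_card_disjoint _ _ M (edge_ball e) _ _ _).
  + apply: (@leq_trans (\sum_(f in M) c)); last exact: leq_sum.
    by rewrite sum_nat_const leq_mul2r dM orbT.
  + by move=> f _; apply: subsetT.
  + by move=> f g x; apply: M_disj.
- have -> : 6 * (\sum_w ecM (phi w)) + 11 * #|T| = \sum_w (6 * ecM (phi w) + 11).
    by rewrite big_split /= -big_distrr /= sum_nat_const [11 * _]mulnC.
  apply: leq_sum => w _; apply/bigmax_leqP => y _.
  have [wM [a aw a_w] _] := phiP w; have [yM [b by_ b_y] _] := phiP y.
  (* The route through the assigned edges has length at most 5 + (6 D + 1) + 5. *)
  apply: leq_trans (dist_within (within_trans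
    (within_trans (within_sym e_sym a_w) (M_dist _ _ _ _ wM yM aw by_)) b_y)) _.
  have := leq_tree_ecc D (phi w) yM; rewrite -/ecM; lia.
- have -> : #|T| * d = \sum_w ecM (phi w) + \sum_w (d - ecM (phi w)).
    rewrite -big_split /= -[LHS]sum_nat_const; apply: eq_bigr => w _.
    by rewrite subnKC // E_le_d; case: (phiP w).
  rewrite leq_add2l; apply: leq_trans (leq_mul (leqnn c) sumM) _.
  (* The fibre of [phi] over f contains the ball of f, so the deficit d - [ecM f] is counted at
     least [c] times. *)
  rewrite (partition_big phi (mem M)) /=; last by move=> w; case: (phiP w).
  rewrite big_distrr /=; apply: leq_sum => f fM.
  rewrite (eq_bigr (fun=> d - ecM f)) => [|w /eqP->//].
  rewrite sum_nat_const leq_mul2r (leq_trans (ball_ge f fM)) ?orbT //.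
  apply/subset_leq_card/subsetP => w wf; rewrite unfold_in.
  by have [_ _ /(_ f fM wf)->] := phiP w; rewrite !eqxx.
- exact: sqr_leq_sum_minn.
Qed.

End EccentricitySum.

(** * From the integer inequalities to the rational bound *)

Unset Implicit Arguments.

Local Open Scope ring_scope.

Lemma weighted_mean_bound (S E N s d c K : rat) :
    S <= 6 * E + 11 * N -> E + c * s <= N * d -> d ^+ 2 <= 4 * s + 1 ->
    N <= K * c -> d + 1 <= K -> 0 < c -> 0 < N -> 0 <= s -> d = 0 \/ 1 <= d ->
  S <= (9 / 2 * K + 8) * N.
Proof.
move=> S_le E_le d_le N_le d_K c0 N0 s0 d_cases.
suff : 4 * E <= N * (3 * K - 2) by nra.
(* For d = 0 the factor d^2 - 1 is negative and N <= K c cannot be multiplied by it; there E <= 0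
   and K >= 1 suffice. *)
case: d_cases => [d0|d1].
  by move: E_le d_K; rewrite d0; nra.
have K0 : 0 < K by lra.
have step1 : 4 * E <= 4 * N * d - c * (d ^+ 2 - 1) by nra.
have step2 : N * (d ^+ 2 - 1) <= K * c * (d ^+ 2 - 1).
  by apply: ler_wpM2r => //; nra.
(* The product of the last two factors is K (3 K - 2) - (4 K d - d^2 + 1), exactly the gap left
   after multiplying [step1] by K and using [step2]. *)
have step3 : 0 <= N * ((K - d - 1) * (3 * K - d + 1)).
  by apply: mulr_ge0; [lra|apply: mulr_ge0; lra].
rewrite -(ler_pM2l K0).
have := ler_wpM2l (ltW K0) step1.
lra.
Qed.

Theorem theorem2 (T : finType) (e : rel T) (n delta : nat)
  (e_simple : simple_graph e)
  (e_conn : connected_graph e)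
  (order_n : #|T| = n)
  (min_deg : min_degree e = delta)
  (delta_ge3 : (3 <= delta)%N)
  (girth_ge6 : girth_at_least e 6) :
  avec e <= 9 / 2 * (Num.ceil (n%:R / delta_star delta))%:~R + 8.
Proof.
have [e_sym e_irr] := e_simple; have [T_gt0 conn] := e_conn.
have delta_gt0 : (0 < delta)%N by apply: leq_trans delta_ge3.
have degree_ge v : (delta <= degree e v)%N.
  by rewrite -min_deg; apply: bigminn_leq; rewrite // mem_index_enum.
have [d [s [E [cT S_le E_le d_le]]]] :=
  sum_ecc_bound e_sym e_irr conn girth_ge6 T_gt0 delta_gt0 degree_ge.
set c := (2 * delta + 2 * delta.-1 ^ 2)%N in cT E_le.
have cE : delta_star delta = c%:R.
  rewrite /delta_star /c; case: (delta) delta_gt0 => // p _.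
  rewrite /= natrD !natrM -(natr1 p); ring.
have c0 : 0 < c%:R :> rat by rewrite ltr0n /c; lia.
have N0 : 0 < n%:R :> rat by rewrite -order_n ltr0n.
rewrite cE /avec order_n (ler_pdivrMr _ _ N0).
set K := (Num.ceil _)%:~R.
have N_le : n%:R <= K * c%:R by rewrite -ler_pdivrMr // ceil_ge.
rewrite order_n in cT S_le E_le.
apply: (weighted_mean_bound _ E%:R _ s%:R d%:R c%:R) => //.
- by rewrite -!natrM -natrD ler_nat.
- by rewrite -!natrM -natrD ler_nat.
- by rewrite -natrX -natrM natr1 ler_nat -[(4 * s)%N.+1]addn1.
(* d + 1 <= K follows from (d + 1) c <= n <= K c. *)
- rewrite -(ler_pM2r c0) natr1 -natrM; apply: le_trans N_le.
  by rewrite ler_nat.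
- by case: (d) => [|d']; [left|right; rewrite ler1n].
Qed.
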